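(* Let $Q$ be a compact all-time controlled invariant set of $\Sigma$ and assume that the fiber map $u\mapsto Q(u)$, defined on $\mathcal U_Q$, is lower semicontinuous. Then, for every compact set $K\subset Q$ with positive volume and every $\varepsilon>0$, $$h_{\mathrm{inv}}(K,Q)\ \ge\ -\liminf_{\tau\to\infty}\sup_{u\in\mathcal U_Q}\frac1\tau\log\mathrm{vol}(Q(u,\tau,\varepsilon)).$$
   Context: Setting: $\Sigma: x_{t+1}=f(x_t,u_t)$ with $f:M\times U\to M$, where $M$ is a connected smooth finite-dimensional manifold with a fixed Riemannian metric (distance $d$, volume $\mathrm{vol}$), $U$ is a compact connected metric space, each $f_u:=f(\cdot,u)$ is a $C^1$-diffeomorphism of $M$ whose derivative depends jointly continuously on $(u,x)$, and $f$ and $(x,u)\mapsto f_u^{-1}(x)$ are continuous. $\mathcal U:=U^{\mathbb Z}$ has the product topology, $(\theta u)_t:=u_{t+1}$. The transition map is $\varphi(t,x,u)=\varphi_{t,u}(x)=f_{u_{t-1}}\circ\cdots\circ f_{u_0}(x)$ for $t>0$, $\varphi(0,x,u)=x$, $\varphi(t,x,u)=f_{u_t}^{-1}\circ\cdots\circ f_{u_{-1}}^{-1}(x)$ for $t<0$. $Q\subset M$ is all-time controlled invariant if for every $x\in Q$ there is $u\in\mathcal U$ with $\varphi(\mathbb Z,x,u)\subset Q$. $Q(u):=\{x\in M:\varphi(\mathbb Z,x,u)\subset Q\}$, $\mathcal U_Q:=\{u\in\mathcal U:Q(u)\ne\emptyset\}$. For $u\in\mathcal U_Q$, $\tau\in\mathbb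 Z_{>0}$, $\varepsilon>0$: $Q(u,\tau,\varepsilon):=\{x\in M:\mathrm{dist}(\varphi(t,x,u),Q(\theta^tu))\le\varepsilon\ \text{for }0\le t<\tau\}$. Lower semicontinuity: for every $u\in\mathcal U_Q$, $x\in Q(u)$ and every sequence $u_k\to u$ in $\mathcal U_Q$ there are $x_k\in Q(u_k)$ with $x_k\to x$. Invariance entropy: a set $\mathcal S\subset\mathcal U$ is $(\tau,K,Q)$-spanning if for every $x\in K$ there is $u\in\mathcal S$ with $\varphi(t,x,u)\in Q$ for $0\le t<\tau$; $r_{\mathrm{inv}}(\tau,K,Q)$ is the minimal cardinality of such a set and $h_{\mathrm{inv}}(K,Q):=\limsup_{\tau\to\infty}\frac1\tau\log r_{\mathrm{inv}}(\tau,K,Q)$. Logarithms are to base 2. *)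

(* Defs.v *)
From HB Require Import structures.
From mathcomp Require Import all_boot all_order all_algebra.
From mathcomp Require Import all_classical all_reals all_analysis.

Set Implicit Arguments.
Unset Strict Implicit.
Unset Printing Implicit Defensive.

Import Order.TTheory GRing.Theory Num.Theory.
Import numFieldNormedType.Exports.

Local Open Scope classical_set_scope.
Local Open Scope ring_scope.

(* Nonempty metric spaces: [g_sigma_algebraType] asks for a pointed type. *)
#[short(type="pmetricType")]
HB.structure Definition PointedMetric (K : numDomainType) :=
  { M of Metric K M & Pointed M }.

Notation borel T := (g_sigma_algebraType (@open T)).

(** * Smooth maps on open subsets of R^n *)

Section smooth.
Context {R : realType} {n : nat} {W : normedModType R}.

Fixpoint Ck (k : nat) (D : set 'rV[R]_n) (f : 'rV[R]_n -> W) : Prop :=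
  if k is k'.+1 then
    (forall x, D x -> differentiable f x) /\
    (forall j : 'I_n, Ck k' D (fun x => 'D_(delta_mx 0 j) f x))
  else forall x, D x -> {for x, continuous f}.

Definition smooth_on (D : set 'rV[R]_n) (f : 'rV[R]_n -> W) : Prop :=
  forall k, Ck k D f.

End smooth.

(** * Smooth manifolds with a Riemannian metric *)

(* Tangent vectors in a chart are row vectors, so differentials act by
   [v |-> v *m jacobian _ _]. The metric tensor is given by its Gram matrices
   [gram i] in the charts. [ichart i] is the inverse of [chart i]; it is
   meaningful only on the image of [chart i]. The manifold topology of [M] is
   the topology of its distance [mdist], for which the charts are
   homeomorphisms; that [mdist] is the distance induced by the Riemannian
   metric is [is_riemannian_distance] below. A connected such [M] is second
   countable. *)
Record riemannian_atlas (R : realType) (n : nat) (M : pmetricType R) :=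
  RiemannianAtlas {
  chart_index : Type;
  cdom : chart_index -> set M;
  chart : chart_index -> M -> 'rV[R]_n;
  ichart : chart_index -> 'rV[R]_n -> M;
  gram : chart_index -> 'rV[R]_n -> 'M[R]_n;
  chart_at : M -> chart_index;
  mem_chart_at : forall x, cdom (chart_at x) x;
  open_cdom : forall i, open (cdom i);
  open_cimg : forall i, open (chart i @` cdom i);
  chartK : forall i x, cdom i x -> ichart i (chart i x) = x;
  continuous_chart : forall i x, cdom i x -> {for x, continuous (chart i)};
  continuous_ichart : forall i y, (chart i @` cdom i) y ->
    {for y, continuous (ichart i)};
  smooth_transition : forall i j,
    smooth_on (chart i @` (cdom i `&` cdom j)) (chart j \o ichart i);
  smooth_gram : forall i, smooth_on (chart i @` cdom i) (gram i);
  gram_sym : forall i y, (chart i @` cdom i) y -> (gram i y)^T = gram i y;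
  gram_gt0 : forall i y, (chart i @` cdom i) y ->
    forall v : 'rV[R]_n, v != 0 -> 0 < (v *m gram i y *m v^T) 0 0;
  gram_transition : forall i j y, (chart i @` (cdom i `&` cdom j)) y ->
    let J := jacobian (chart j \o ichart i) y in
    gram i y = J *m gram j (chart j (ichart i y)) *m J^T
}.

Section riemannian.
Context {R : realType} {n : nat} {M : pmetricType R}.
Variable X : riemannian_atlas n M.

(* Only [c] on [0, 1] matters for the length; being C^1 up to the end points is expressed by
   differentiability on a neighborhood of each point of [0, 1]. *)
Definition C1_curve (c : R -> M) : Prop :=
  forall t : R, 0 <= t <= 1 ->
    {for t, continuous c} /\
    forall i : chart_index X, cdom i (c t) ->
      (\forall s \near t, derivable (chart i \o c) s 1) /\
      {for t, continuous (derive1 (chart i \o c))}.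

Definition speed (c : R -> M) (t : R) : R :=
  let i := chart_at X (c t) in
  let v := derive1 (chart i \o c) t in
  Num.sqrt ((v *m gram i (chart i (c t)) *m v^T) 0 0).

Definition curve_length (c : R -> M) : \bar R :=
  (\int[lebesgue_measure]_(t in `[0%R, 1%R]) (speed c t)%:E)%E.

(* [path_length x y l]: some piecewise C^1 curve from [x] to [y], given as a
   finite concatenation of C^1 curves, has length [l]. *)
Inductive path_length (x : M) : M -> \bar R -> Prop :=
| path_nil : path_length x x 0%E
| path_rcons (c : R -> M) (l : \bar R) :
    path_length x (c 0) l -> C1_curve c ->
    path_length x (c 1) (l + curve_length c)%E.

Definition is_riemannian_distance : Prop :=
  forall x y : M, (mdist x y)%:E = ereal_inf [set l | path_length x y l].

(* Being locally finite, a measure on R^n is determined by its values on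
   boxes, so this characterizes Lebesgue measure on the Borel sets. *)
Definition is_lebesgue (leb : {measure set (borel 'rV[R]_n) -> \bar R}) : Prop :=
  forall a b : 'rV[R]_n, (forall j, a 0 j <= b 0 j) ->
    leb [set x | forall j, a 0 j <= x 0 j <= b 0 j]
      = (\prod_(j < n) (b 0 j - a 0 j))%:E.

Definition is_riemannian_volume
    (leb : {measure set (borel 'rV[R]_n) -> \bar R})
    (vol : {measure set (borel M) -> \bar R}) : Prop :=
  forall (i : chart_index X) (A : set (borel M)), measurable A -> A `<=` cdom i ->
    vol A = (\int[leb]_(y in chart i @` A)
               (Num.sqrt (\det (gram i y)))%:E)%E.

Definition local_rep (i j : chart_index X) (h : M -> M) : 'rV[R]_n -> 'rV[R]_n :=
  chart j \o h \o ichart i.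

Definition C1_map (h : M -> M) : Prop :=
  continuous h /\
  forall (i j : chart_index X) x, cdom i x -> cdom j (h x) ->
    differentiable (local_rep i j h) (chart i x) /\
    {for x, continuous (fun z => jacobian (local_rep i j h) (chart i z))}.

End riemannian.

(** * Control systems *)

Record control_system (R : realType) (n : nat) (M : pmetricType R)
    (X : riemannian_atlas n M) (U : metricType R) := ControlSystem {
  step : M -> U -> M;
  istep : M -> U -> M;
  stepK : forall u, cancel (step^~ u) (istep^~ u);
  istepK : forall u, cancel (istep^~ u) (step^~ u);
  continuous_step : continuous (fun p : M * U => step p.1 p.2);
  continuous_istep : continuous (fun p : M * U => istep p.1 p.2);
  C1_step : forall u, C1_map X (step^~ u);
  C1_istep : forall u, C1_map X (istep^~ u);
  continuous_jacobian_step : forall (i j : chart_index X) x u,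
    cdom i x -> cdom j (step x u) ->
    {for (x, u), continuous (fun p : M * U =>
       jacobian (local_rep i j (step^~ p.2)) (chart i p.1))}
}.

Definition dist_to {R : realType} {M : metricType R} (x : M) (A : set M) : R :=
  inf [set mdist x a | a in A].

Section dynamics.
Context {R : realType} {n : nat} {M : pmetricType R}
  {X : riemannian_atlas n M} {U : metricType R}.
Variable S : control_system X U.

Definition control := {ptws int -> U}.

Definition theta (w : control) : control := fun t : int => w (t + 1).

Fixpoint fwd (k : nat) (x : M) (w : control) : M :=
  if k is k'.+1 then step S (fwd k' x w) (w k'%:Z) else x.

Fixpoint bwd (k : nat) (x : M) (w : control) : M :=
  if k is k'.+1 then istep S (bwd k' x w) (w (- (k'.+1%:Z))) else x.

(* [Negz k] is the integer [- k.+1]. *)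
Definition transition (t : int) (x : M) (w : control) : M :=
  match t with Posz k => fwd k x w | Negz k => bwd k.+1 x w end.

Variable Q : set M.

Definition all_time_controlled_invariant : Prop :=
  forall x, Q x -> exists w : control, forall t : int, Q (transition t x w).

Definition fiber (w : control) : set M :=
  [set x | forall t : int, Q (transition t x w)].

Definition admissible : set control := [set w | fiber w !=set0].

Definition fiber_lsc : Prop :=
  forall (w : control) (x : M) (w_ : nat -> control),
    admissible w -> fiber w x -> (forall k, admissible (w_ k)) ->
    w_ @ \oo --> w ->
    exists2 x_ : nat -> M, (forall k, fiber (w_ k) (x_ k)) & x_ @ \oo --> x.

Definition fiber_nbhd (w : control) (tau : nat) (eps : R) : set M :=
  [set x | forall t : nat, (t < tau)%N ->
     dist_to (transition t x w) (fiber (iter t theta w)) <= eps].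

Definition spanning (tau : nat) (K : set M) (W : set control) : Prop :=
  forall x, K x -> exists2 w, W w &
    forall t : nat, (t < tau)%N -> Q (transition t x w).

(* [+oo] when there is no finite spanning set. *)
Definition rinv (tau : nat) (K : set M) : \bar R :=
  ereal_inf [set (k%:R : R)%:E | k in
    [set k | exists2 W : set control, spanning tau K W & (W #= `I_k)%card]].

End dynamics.

(* Base 2 logarithm, with [log2e 0 = -oo] and [log2e +oo = +oo]. *)
Definition log2e {R : realType} (x : \bar R) : \bar R :=
  (((ln (2 : R))^-1)%:E * lne x)%E.

(* The value of the sequence at [tau = 0] does not affect the limit. *)
Definition hinv {R : realType} {n : nat} {M : pmetricType R}
    {X : riemannian_atlas n M} {U : metricType R} (S : control_system X U)
    (K Q : set M) : \bar R :=
  limn_esup (fun tau : nat => ((tau%:R : R)^-1)%:E * log2e (rinv S Q tau K))%E.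

(* Main.v *)
(** Lower semicontinuity and compactness of the graph of [u |-> Q(u)] give a
    modulus of continuity: controls in [U_Q] that are close on a long enough window
    [[-N, N]] have fibers within [eps] of each other. If [w] keeps [x] in [Q] during
    [0 <= t < tau], then gluing to [w] controls that keep the two end points of this
    trajectory in [Q] for all times gives a control [u_x] with [x] in [Q(u_x)].
    The set of points kept in [Q] by [w] splits into boundedly many classes,
    independently of [tau] and [w], such that within a class the controls [u_x] and
    their shifts are close on the window; each class lies in a single [Q(u, tau, eps)]. Hence
    [vol K <= C * r_inv * sup_u vol(Q(u, tau, eps))] with [C] independent of [tau]. *)

Require Import Defs.
From mathcomp Require Import all_boot all_order all_algebra.
From mathcomp Require Import all_classical all_reals all_analysis.
From mathcomp Require Import zify lra.
Import Order.TTheory GRing.Theory Num.Theory.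
Import numFieldNormedType.Exports.
Local Open Scope classical_set_scope.
Local Open Scope ring_scope.

Set Implicit Arguments.
Unset Strict Implicit.
Unset Printing Implicit Defensive.

(** * Cocycle property, locality and continuity of the transition map *)

Section transition.
Context {R : realType} {n : nat} {M : pmetricType R}
  {X : riemannian_atlas n M} {U : metricType R} (S : control_system X U).
Local Notation control := (@control R U).
Local Notation theta := (@theta R U).
Implicit Types (w v : control) (x : M) (Q : set M).

Lemma iter_theta (t : nat) w (s : int) : iter t theta w s = w (s + t%:Z).
Proof.
elim: t s => [|t IH] s /=; first by rewrite addr0.
by rewrite /Defs.theta IH; congr w; lia.
Qed.

(** For [s < 0] the first backward step along [theta w] reads [w 0] and undoes [step S x (w 0)]. *)
Lemma transition_theta (s : int) x w :
  transition S s (step S x (w 0)) (theta w) = transition S (s + 1) x w.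
Proof.
case: s => k.
  have -> : Posz k + 1 = Posz k.+1 by lia.
  elim: k => [|k] //= ->; rewrite /Defs.theta.
  by congr (step _ _ (w _)); lia.
elim: k => [|k IH]; first by rewrite /= /Defs.theta stepK.
have -> : Negz k.+1 + 1 = Negz k by lia.
move: IH; case: k => [|k].
  by rewrite /= => ->; congr (istep _ _ (w _)); lia.
have -> : Negz k.+1 + 1 = Negz k by lia.
by rewrite /= => ->; congr (istep _ _ (w _)); rewrite /Defs.theta; lia.
Qed.

Lemma transition_iter_theta (t : nat) (s : int) x w :
  transition S s (fwd S t x w) (iter t theta w)
    = transition S (s + t%:Z) x w.
Proof.
elim: t s => [|t IH] s /=; first by rewrite addr0.
have {1}-> : w t = iter t theta w 0 by rewrite iter_theta add0r.
by rewrite transition_theta IH; congr transition; lia.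
Qed.

Lemma fiber_fwd Q (t : nat) x w :
  fiber S Q w x -> fiber S Q (iter t theta w) (fwd S t x w).
Proof. by move=> Qx s; rewrite transition_iter_theta; exact: Qx. Qed.

Lemma admissible_iter_theta Q (t : nat) w :
  admissible S Q w -> admissible S Q (iter t theta w).
Proof. by move=> [x Qx]; exists (fwd S t x w); exact: fiber_fwd. Qed.

Lemma eq_fwd (k : nat) x w v :
  (forall i : nat, (i < k)%N -> w i = v i) -> fwd S k x w = fwd S k x v.
Proof.
elim: k => //= k IH wv; rewrite wv// IH// => i ik.
by rewrite wv// ltnW.
Qed.

Lemma eq_bwd (k : nat) x w v :
  (forall i : nat, (i < k)%N -> w (Negz i) = v (Negz i)) ->
  bwd S k x w = bwd S k x v.
Proof.
elim: k => //= k IH wv; rewrite IH => [|i ik]; last by rewrite wv// ltnW.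
by congr istep; exact: wv.
Qed.

Lemma continuous_transition (s : int) :
  continuous (fun p : control * M => transition S s p.2 p.1).
Proof.
have evc (r : int) : continuous (fun p : control * M => p.1 r).
  move=> p; apply: (@continuous_comp _ _ _ fst (fun w : control => w r)).
    exact: cvg_fst.
  exact: (@proj_continuous _ (fun=> U) r).
case: s => k.
  elim: k => [|k IH] p /=; first exact: cvg_snd.
  apply: (@continuous_comp _ _ _
    (fun p : control * M => (fwd S k p.2 p.1, p.1 k%:Z))
    (fun q : M * U => step S q.1 q.2)).
    by apply: cvg_pair; [exact: IH|exact: evc].
  exact: continuous_step.
rewrite /transition; elim: k.+1 => {k} [|k IH] p /=; first exact: cvg_snd.
apply: (@continuous_comp _ _ _
  (fun p : control * M => (bwd S k p.2 p.1, p.1 (- k.+1%:Z)))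
  (fun q : M * U => istep S q.1 q.2)).
  by apply: cvg_pair; [exact: IH|exact: evc].
exact: continuous_istep.
Qed.

(** The graph is an intersection, over all times, of preimages of [Q] under jointly continuous
    maps. *)
Lemma closed_fiber_graph Q : closed Q ->
  closed [set p : control * M | fiber S Q p.1 p.2].
Proof.
move=> cQ.
have -> : [set p : control * M | fiber S Q p.1 p.2] =
    \bigcap_(s in [set: int]) ((fun p => transition S s p.2 p.1) @^-1` Q).
  by apply/seteqP; split => p /= Hp s => [_|]; exact: Hp.
apply: closed_bigI => s _; apply: preimage_closed => //.
by move=> p _; exact: continuous_transition.
Qed.

End transition.

(** * Distance to a set *)

Section dist_to.
Context {R : realType} {M : metricType R}.
Implicit Types (x y : M) (A : set M).

Lemma dist_to_le_mdist x A y : A y -> dist_to x A <= mdist x y.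
Proof.
move=> Ay; apply: inf_lbound; last by exists y.
by exists 0 => _ [z _ <-]; exact: mdist_ge0.
Qed.

Lemma dist_to_lipschitz A x y : A !=set0 ->
  dist_to x A <= dist_to y A + mdist x y.
Proof.
move=> [a Aa]; rewrite -lerBlDr; apply: lb_le_inf; first by exists (mdist y a), a.
move=> _ [z Az <-]; rewrite lerBlDr.
by rewrite (le_trans (dist_to_le_mdist x Az))// addrC metric_triangle.
Qed.

Lemma closed_dist_to_le A (e : R) : A !=set0 -> closed [set x | dist_to x A <= e].
Proof.
move=> A0 x clx /=; apply/ler_addgt0Pr => d d0.
have [y [/= yA]] := clx _ (nbhsx_ballx x d d0).
rewrite ballEmdist /= => xy.
by rewrite (le_trans (dist_to_lipschitz x y A0))// lerD// ltW.
Qed.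

End dist_to.

(** * Uniform modulus of continuity of the fiber map *)

Section fiber_modulus.
Context {R : realType} {n : nat} {M : pmetricType R}
  {X : riemannian_atlas n M} {U : metricType R} (S : control_system X U).
Local Notation control := (@control R U).
Implicit Types (w v : control) (x : M).

(** A single parameter governs both window and radius, so that [k]-closeness for growing [k] forces
    convergence in the product topology. *)
Definition control_close (k : nat) w v :=
  forall s : int, (`|s| <= k)%N -> mdist (w s) (v s) < k.+1%:R^-1.

Lemma cvg_control_close (w_ : nat -> control) w :
  (forall k, control_close k w (w_ k)) -> w_ @ \oo --> w.
Proof.
move=> ww_; apply/cvg_sup => s; apply/cvg_image.
  by apply/seteqP; split => // u _; exists (fun=> u).
move=> V /= /nbhs_ballP[e /= e0 eV].
exists [set v : control | V (v s)]; last first.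
  by apply/seteqP; split => [_ [v /= Vv <-]|u Vu]//; exists (fun=> u).
rewrite /= near_simpl; near=> k; apply: eV; rewrite ballEmdist /=.
apply: (@lt_trans _ _ k.+1%:R^-1).
  by apply: ww_; near: k; exact: nbhs_infty_ge.
by near: k; exact: near_infty_natSinv_lt (PosNum e0).
Unshelve. all: by end_near. Qed.

Lemma near_mdist_control w (k : nat) (e : R) : 0 < e ->
  \forall v \near w, forall s : int, (`|s| <= k)%N -> mdist (w s) (v s) < e.
Proof.
move=> e0.
have nearc (s : int) : \forall v \near w, mdist (w s) (v s) < e.
  have := @proj_continuous _ (fun=> U) s w _ (nbhsx_ballx (w s) e e0).
  by rewrite ballEmdist.
have FF : Filter (nbhs w) by exact: nbhs_pfilter.
(* Each index [i] handles the times [i] and [- i], so finitely many coordinate conditions cover the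
   window. *)
have := @filter_forall _ 'I_k.+1 (fun i v => mdist (w i%:Z) (v i%:Z) < e /\
  mdist (w (- i%:Z)) (v (- i%:Z)) < e) (nbhs w) FF
  (fun i => @filterI _ _ FF _ _ (nearc i) (nearc (- i%:Z))).
apply: filterS => v /= wv s sk.
have [wvp wvn] := wv (Ordinal (sk : (absz s < k.+1)%N)).
have [sE|sE] : s = `|s|%N%:Z \/ s = - `|s|%N%:Z by lia.
  by rewrite sE.
by rewrite sE.
Qed.

Variable Q : set M.
Hypothesis lscQ : fiber_lsc S Q.

(** If every [k] failed, the counterexamples would form a sequence of controls tending to [w] whose
    fibers all stay at distance at least [e] from [x], against lower semicontinuity. *)
Lemma fiber_lsc_close w x (e : R) : admissible S Q w -> fiber S Q w x -> 0 < e ->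
  exists k, forall v, admissible S Q v -> control_close k w v ->
    exists2 y, fiber S Q v y & mdist x y < e.
Proof.
move=> aw wx e0; apply: contrapT => /forallNP noK.
have {}noK k : exists v, [/\ admissible S Q v, control_close k w v &
    forall y, fiber S Q v y -> e <= mdist x y].
  have /existsNP[v /not_implyP[av /not_implyP[wv nv]]] := noK k.
  exists v; split => // y vy; rewrite leNgt; apply/negP => xy.
  by apply: nv; exists y.
have [w_ w_P] := choice noK.
have [] := lscQ aw wx (fun k => (let: And3 a _ _ := w_P k in a)).
  by apply: cvg_control_close => k; have [] := w_P k.
move=> x_ x_fib /metricType_numDomainType.cvgrPdist_lt/(_ e e0)[k _ /(_ k (leqnn k))].
by have [_ _ /(_ _ (x_fib k))] := w_P k; rewrite leNgt => /negP.
Qed.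

(** The graph is closed in the compact space of controls times [Q]. Around each of its points the
    pointwise estimate persists, half of [e] being spent on moving [x] and half of the radius on
    moving [w]; compactness then yields one [k] for all points. *)
Lemma fiber_modulus (e : R) : compact [set: U] -> compact Q -> 0 < e ->
  exists k, forall w v x, admissible S Q v -> fiber S Q w x ->
    control_close k w v -> dist_to x (fiber S Q v) <= e.
Proof.
move=> cU cQ e0.
have cG : compact [set p : control * M | fiber S Q p.1 p.2].
  apply: (@subclosed_compact _ _ (setT `*` Q)).
  - by apply: closed_fiber_graph; apply: compact_closed => //; exact: metric_hausdorff.
  - apply: compact_setX => //.
    have := @tychonoff int (fun=> U) (fun=> setT) (fun=> cU).
    by congr compact; apply/seteqP; split.
  - by move=> [w x] /= wx; split => //; exact: (wx 0).
pose P (k : nat) (p : control * M) := forall v, admissible S Q v ->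
  control_close k p.1 v -> dist_to p.2 (fiber S Q v) <= e.
have /(_ nat \oo P _)[|k _ kP] := (iffLR (compact_near_coveringP _)) cG.
  move=> [w x] /= wx.
  have e20 : 0 < e / 2 by rewrite divr_gt0.
  have [|k kP] := fiber_lsc_close _ wx e20; first by exists x.
  pose d : R := k.+1%:R^-1 / 2.
  have d0 : 0 < d by rewrite divr_gt0// invr_gt0.
  have near_w : \forall p \near (w, x),
      forall s : int, (`|s| <= k)%N -> mdist (w s) (p.1 s) < d.
    exists ([set v : control | forall s : int, (`|s| <= k)%N ->
      mdist (w s) (v s) < d], setT); last by move=> p [].
    by split; [exact: near_mdist_control|exact: filterT].
  have near_x : \forall p \near (w, x), mdist x p.2 < e / 2.
    exists (setT, [set y | mdist x y < e / 2]); last by move=> p [].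
    split; first exact: filterT.
    by rewrite -ballEmdist; exact: nbhsx_ballx.
  near=> p l.
  have pw : forall s : int, (`|s| <= k)%N -> mdist (w s) (p.1 s) < d by near: p.
  have px : mdist x p.2 < e / 2 by near: p.
  have ld : l.+1%:R^-1 < d.
    by near: l; exact: near_infty_natSinv_lt (PosNum d0).
  have kl : (k <= l)%N by near: l; exact: nbhs_infty_ge.
  move=> v av pv.
  have [s sk|y vy xy] := kP v av.
    rewrite (le_lt_trans (metric_triangle _ (p.1 s) _))//.
    rewrite [ltRHS]splitr ltrD//; first exact: pw.
    by rewrite (lt_trans _ ld)// pv// (leq_trans sk).
  rewrite (le_trans (dist_to_le_mdist _ vy))//.
  rewrite (le_trans (metric_triangle _ x _))// [leRHS]splitr lerD//.
    by rewrite metric_sym ltW.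
  exact: ltW.
exists k => w v x av wx wv.
exact: (kP k (leqnn k) (w, x)).
Unshelve. all: by end_near. Qed.

End fiber_modulus.

(** * Finite classes of controls and the induced covering *)

Lemma compact_fin_partition (R : realType) (U : metricType R) (d : R) :
  compact [set: U] -> 0 < d ->
  exists m (c : U -> 'I_m), forall u v, c u = c v -> mdist u v < d.
Proof.
move=> cU d0; have d20 : 0 < d / 2 by rewrite divr_gt0.
(* Finite lists of centers, ordered by inclusion: a property holding eventually along [F] holds for
   some finite list [D], which gives a finite subcover. *)
pose F : set_system (seq U) := filter_from [set: seq U] (fun s => [set t | {subset s <= t}]).
have FF : Filter F.
  apply: filter_from_filter; first by exists [::].
  move=> s t _ _; exists (s ++ t) => // r /= str.
  by split => u ut; apply: str; rewrite mem_cat ut ?orbT.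
have [u _|D _ /(_ D (fun _ => id)) DU] := iffLR (compact_near_coveringP _) cU _ F
    (fun s u => exists2 z, z \in s & mdist z u < d / 2) FF.
  exists (ball u (d / 2), [set t | {subset [:: u] <= t}]).
    by split; [exact: nbhsx_ballx|exists [:: u]].
  move=> [v t] /=; rewrite ballEmdist => -[/= uv ut].
  by exists u => //; apply: ut; rewrite mem_head.
pose near_pt (u z : U) := mdist z u < d / 2.
have hasD u : has (near_pt u) D.
  by have [z zD zu] := DU u Logic.I; apply/hasP; exists z.
have ltD u : (find (near_pt u) D < size D)%N by rewrite -has_find.
(* The class of a point is the position of the first center within [d / 2]; points of one class
   share that center. *)
exists (size D), (fun u => Ordinal (ltD u)) => u v [uv].
have zu := nth_find u (hasD u); have zv := nth_find u (hasD v).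
rewrite -uv in zv; rewrite (le_lt_trans (metric_triangle _ (nth u D (find (near_pt u) D)) _))//.
by rewrite [ltRHS]splitr ltrD// metric_sym.
Qed.

Section covering.
Context {R : realType} {n : nat} {M : pmetricType R}
  {X : riemannian_atlas n M} {U : metricType R} (S : control_system X U).
Local Notation control := (@control R U).
Local Notation theta := (@theta R U).
Variable Q : set M.
Implicit Types (w v u : control) (x : M).

(** Glue three controls: [a], keeping [x] in [Q], before time [0]; [w] on [[0, T)]; and from [T] on
    [b], keeping the state at time [T] in [Q], delayed by [T]. *)
Lemma extend_control (T : nat) w x : all_time_controlled_invariant S Q ->
  (forall t : nat, (t < T.+1)%N -> Q (transition S t x w)) ->
  exists2 u, fiber S Q u x & forall i : nat, (i < T)%N -> u i = w i.
Proof.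
move=> invQ Qx.
have [a Qa] := invQ _ (Qx 0 isT); have [b Qb] := invQ _ (Qx T (leqnn _)).
pose u : control := fun t => match t with
  | Posz i => if (i < T)%N then w i else b (i - T)%N
  | Negz _ => a t end.
have uw i : (i < T)%N -> u (Posz i) = w i by rewrite /u => ->.
exists u => // -[k|k]; last first.
  have -> : transition S (Negz k) x u = transition S (Negz k) x a.
    exact: eq_bwd.
  exact: Qa.
have [kT|Tk] := leqP k T.
  have -> : transition S k x u = transition S k x w.
    by apply: eq_fwd => i ik; rewrite uw// (leq_trans ik).
  exact: Qx.
have -> : transition S k x u = transition S (k - T)%N (transition S T x w) b.
  rewrite -{1}(subnK (ltnW Tk)); elim: (k - T)%N => [|j IH].
    by apply: eq_fwd => i iT; rewrite uw.
  rewrite addSn /= in IH *; rewrite IH; congr step.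
  by rewrite ltnNge leq_addl /= addnK.
exact: Qb.
Qed.

(* The control extending [w] so that [x] lies in its fiber depends on [x], but, up to
   the modulus of the fiber map, only through the classes of its values at finitely
   many times before [0] and after [T], the number of which does not depend on [T]. *)
Lemma fiber_nbhd_cover (eps : R) : compact [set: U] -> compact Q ->
  all_time_controlled_invariant S Q -> fiber_lsc S Q -> 0 < eps ->
  exists J : finType, forall (T : nat) w, exists F : J -> control,
    forall x, (forall t : nat, (t < T.+1)%N -> Q (transition S t x w)) ->
    exists2 j, admissible S Q (F j) & fiber_nbhd S Q (F j) T.+1 eps x.
Proof.
move=> cU cQ invQ lscQ eps0.
have [N NP] := fiber_modulus lscQ cU cQ eps0.
have N0 : (0 : R) < N.+1%:R^-1 by rewrite invr_gt0.
have [m [c cP]] := compact_fin_partition cU N0.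
pose window := {ffun 'I_N.+1 -> 'I_m}.
exists (window * window)%type => T w.
(* The classes at times [-N-1, ..., -1] and [T, ..., T+N] suffice: shifting by [t <= T] and looking
   at [[-N, N]] only reaches times in [[-N, T+N]], and on [[0, T)] all extensions equal [w]. *)
pose cls u : window * window :=
  ([ffun i : 'I_N.+1 => c (u (Negz i))], [ffun i : 'I_N.+1 => c (u (T + i)%N)]).
pose ext x u := fiber S Q u x /\ forall i : nat, (i < T)%N -> u i = w i.
have FP j : exists v, forall x u, ext x u -> cls u = j ->
    admissible S Q v /\ fiber_nbhd S Q v T.+1 eps x.
  have [[x0 [u0 [[u0x0 u0w] u0j]]]|no] :=
    pselect (exists x u, ext x u /\ cls u = j); last first.
    by exists w => x u xu uj; exfalso; apply: no; exists x, u.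
  (* One extension [u0] represents its whole class: [u] and [u0] drive [x] along the same path up to
     time [T], and that path lies in the fibers of the shifts of [u], which are close to those of
     [u0]. *)
  exists u0 => x u [ux uw] uj; split; first by exists x0.
  move=> t; rewrite ltnS => tT.
  have -> : transition S t x u0 = fwd S t x u.
    by apply: eq_fwd => i it; rewrite u0w ?uw// (leq_trans it).
  apply: (NP (iter t theta u)).
  - by apply: admissible_iter_theta; exists x0.
  - exact: fiber_fwd.
  move=> s sN; rewrite !iter_theta.
  case rE: (s + t%:Z) => [r|r]; last first.
    apply: cP; have rN : (r < N.+1)%N by lia.
    have : (cls u).1 (Ordinal rN) = (cls u0).1 (Ordinal rN) by rewrite uj u0j.
    by rewrite !ffunE.
  have [rT|Tr] := ltnP r T; first by rewrite u0w ?uw// mdistxx.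
  apply: cP; have rN : (r - T < N.+1)%N by lia.
  have : (cls u).2 (Ordinal rN) = (cls u0).2 (Ordinal rN) by rewrite uj u0j.
  by rewrite !ffunE /= subnKC.
have [F {}FP] := choice FP.
exists F => x Qx; have [u ux uw] := extend_control invQ Qx.
by have [] := FP (cls u) x u (conj ux uw) erefl; exists (cls u).
Qed.

(** Provides Borel measurability of the sets whose volume is taken. *)
Lemma closed_fiber_nbhd w (tau : nat) (eps : R) : admissible S Q w ->
  closed (fiber_nbhd S Q w tau eps).
Proof.
move=> aw.
have -> : fiber_nbhd S Q w tau eps = \bigcap_(t in [set t | (t < tau)%N])
    ((fun x => transition S t x w) @^-1`
       [set y | dist_to y (fiber S Q (iter t theta w)) <= eps]).
  by [].
apply: closed_bigI => t _; apply: preimage_closed; last first.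
  exact: closed_dist_to_le (admissible_iter_theta t aw).
move=> x _; apply: (@continuous_comp _ _ _ (pair w)
  (fun p : control * M => transition S t p.2 p.1)).
  exact: (cvg_pair (cvg_cst w) cvg_id).
exact: continuous_transition.
Qed.

End covering.

(** * Measure, upper limit and logarithm estimates *)

Lemma closed_borel (T : ptopologicalType) (A : set T) :
  closed A -> measurable (A : set (borel T)).
Proof.
move=> cA; rewrite -(setCK A); apply: measurableC.
by apply: sub_sigma_algebra; exact: closed_openC.
Qed.

(** Finite subadditivity, with every term bounded by the largest [mu (F i)]; a point of [A] ensures
    that [I] is inhabited. *)
Lemma measure_le_card_max d (R : realType) (T : measurableType d)
    (mu : {measure set T -> \bar R}) (I : finType) (A : set T) (F : I -> set T) :
  measurable A -> (forall i, measurable (F i)) -> A !=set0 ->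
  (forall x, A x -> exists i, F i x) ->
  exists i, (mu A <= (#|I|%:R)%:E * mu (F i))%E.
Proof.
move=> mA mF [a Aa] AF; have [i0 _] := AF a Aa.
case: (Order.TotalTheory.arg_maxP (fun i => mu (F i)) (isT : xpredT i0)).
move=> i _ imax; exists i.
have AU : A `<=` \bigcup_(j in [set: I]) F j.
  by move=> x /AF[j Fx]; exists j.
rewrite (le_trans (content_sub_fsum mu (@finite_finset _ _) _ mA AU))//.
rewrite (fsbigE (enum I)) ?enum_uniq//; last by move=> j _; rewrite mem_enum.
have -> : ((#|I|%:R)%:E * mu (F i) = \sum_(j in I) mu (F i))%E.
  by rewrite sumr_const mule_natl.
rewrite big_enum_cond [leLHS](eq_bigl [in I]) => [|j]; last by rewrite in_setT andbT.
by apply: lee_sum => j _; exact: imax.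
Qed.

Lemma limn_esup_le_near (R : realType) (u v : (\bar R)^nat) :
  (forall e : R, 0 < e -> \forall k \near \oo, (u k <= v k + e%:E)%E) ->
  (limn_esup u <= limn_esup v)%E.
Proof.
move=> uv; apply/lee_addgt0Pr => e e0; rewrite -leeBlDr//.
apply: le_ereal_inf_tmp => _ [A ooA <-]; rewrite leeBlDr//.
(* Shrinking a tail set [A] to the indices where the inequality holds keeps it in the filter and
   does not raise the supremum of [v]. *)
apply: ge_ereal_inf; exists (ereal_sup (u @` (A `&` [set k | u k <= v k + e%:E]%E))).
  by eexists; [exact: filterI ooA (uv e e0)|].
apply: ge_ereal_sup => _ [k [Ak uvk] <-]; rewrite (le_trans uvk)// leeD2r//.
by apply: ereal_sup_ubound; exists k.
Qed.

Lemma log2e_EFin (R : realType) (r : R) : 0 < r ->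
  log2e r%:E = (ln r / ln 2)%:E.
Proof. by move=> r0; rewrite /log2e lne_EFin// -EFinM mulrC. Qed.

Lemma log2ey (R : realType) : log2e (+oo%E : \bar R) = +oo%E.
Proof. by rewrite /log2e /= gt0_muley// lte_fin invr_gt0 ln_gt0// ltr1n. Qed.

(** Logarithm of the volume inequality, scaled by [t], the inverse time. Positivity of [v] forces
    [k], [C] and [V] to be positive; for infinite [V] the left side is [-oo]. *)
Lemma oppe_log2e_le (R : realType) (t v : R) (k C : nat) (V : \bar R) :
  0 < t -> 0 < v -> (0 <= V)%E -> (v%:E <= ((k * C)%:R)%:E * V)%E ->
  (- (t%:E * log2e V) <=
   t%:E * log2e (k%:R)%:E + ((ln C%:R - ln v) / ln 2 * t)%:E)%E.
Proof.
move=> t0 v0; case: V => [r| |]//; last first.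
  by move=> _ _; rewrite log2ey gt0_muley ?lte_fin// leNye.
rewrite lee_fin => r0; rewrite -EFinM lee_fin => vr.
have kCr0 : 0 < (k * C)%:R * r by exact: (lt_le_trans v0 vr).
have r_gt0 : 0 < r.
  by rewrite lt_neqAle r0 andbT; apply: contraTneq kCr0 => <-; rewrite mulr0 ltxx.
have : (0 < k * C)%N by rewrite lt0n; apply: contraTneq kCr0 => ->; rewrite mul0r ltxx.
rewrite muln_gt0 => /andP[k0 C0].
rewrite !log2e_EFin ?ltr0n// -!EFinM -EFinN -EFinD lee_fin.
have lnv : ln v <= ln k%:R + ln C%:R + ln r.
  rewrite -lnM ?posrE ?ltr0n// -natrM -lnM ?posrE ?ltr0n ?muln_gt0 ?k0//.
  by rewrite ler_ln ?posrE.
rewrite [_ * t in leRHS]mulrC -mulrDr -mulrN ler_pM2l//.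
by rewrite -mulNr -mulrDl ler_pM2r ?invr_gt0 ?ln_gt0 ?ltr1n//; lra.
Qed.

(** * Volume bound through spanning sets *)

Section spanning_bound.
Context {R : realType} {n : nat} {M : pmetricType R}
  {X : riemannian_atlas n M} {U : metricType R} (S : control_system X U).
Variables (Q K : set M) (eps : R) (vol : {measure set (borel M) -> \bar R}).
Hypotheses (compU : compact [set: U]) (compQ : compact Q).
Hypotheses (invQ : all_time_controlled_invariant S Q) (lscQ : fiber_lsc S Q).
Hypotheses (compK : compact K) (volK : (0 < vol K)%E) (eps_gt0 : 0 < eps).

Lemma spanning_vol_le : exists C : nat, forall T k W,
  spanning S Q T.+1 K W -> (W #= `I_k)%card ->
  exists2 w, admissible S Q w &
    (vol K <= ((k * C)%:R)%:E * vol (fiber_nbhd S Q w T.+1 eps))%E.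
Proof.
have [J JP] := fiber_nbhd_cover compU compQ invQ lscQ eps_gt0.
(* [C] counts the classes, whose number depends neither on [T] nor on [W]; [K] is covered by at most
   one set per control of [W] and class. *)
exists #|J| => T k W spW /card_set_bijP[f [fW finj _]].
have [F FP] := choice (JP T).
have K0 : K !=set0.
  by apply/set0P/eqP => K0; move: volK; rewrite K0 measure0 ltxx.
have [x0 Kx0] := K0; have [w0 _ _] := spW _ Kx0.
(* [g] inverts the enumeration [f] of [W], with [w0] as default value. *)
have gP (i : 'I_k) : exists w, forall v, W v -> f v = i -> v = w.
  have [[w [Ww wi]]|no] := pselect (exists w, W w /\ f w = i); last first.
    by exists w0 => v Wv vi; exfalso; apply: no; exists v.
  by exists w => v Wv vi; apply: finj; rewrite ?inE// vi wi.
have [g {}gP] := choice gP.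
pose u (p : 'I_k * J) := F (g p.1) p.2.
(* Inadmissible pairs get the empty set; [vol K > 0] prevents such a pair from being the maximizing
   one. *)
pose G (p : 'I_k * J) : set (borel M) :=
  if `[< admissible S Q (u p) >] then fiber_nbhd S Q (u p) T.+1 eps else set0.
have [||//|x Kx|p] := @measure_le_card_max _ _ _ vol _ K G.
- by apply: closed_borel; apply: compact_closed => //; exact: metric_hausdorff.
- move=> p; rewrite /G; case: asboolP => [up|_]; last exact: measurable0.
  by apply: closed_borel; exact: closed_fiber_nbhd.
- have [w Ww Qx] := spW _ Kx.
  have fwk : (f w < k)%N by exact: fW.
  have gw : g (Ordinal fwk) = w by rewrite -(gP (Ordinal fwk) w).
  have [j uj xj] := FP w x Qx; exists (Ordinal fwk, j).
  by rewrite /G /u/= gw; case: asboolP.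
rewrite card_prod card_ord /G; case: asboolP => [up|_] leK; first by exists (u p).
by move: volK; rewrite ltNge (le_trans leK)// measure0 mule0.
Qed.

(** A nonempty set of naturals has a least element; the infimum of the empty set is [+oo]. *)
Lemma rinv_attained T : rinv S Q T K = +oo%E \/ exists k W,
  [/\ spanning S Q T K W, (W #= `I_k)%card & rinv S Q T K = (k%:R)%:E].
Proof.
pose A := [set k : nat | exists2 W, spanning S Q T K W & (W #= `I_k)%card].
have [[k Ak]|noA] := pselect (exists k, A k); last first.
  left; rewrite /rinv -(ereal_inf0 R); congr ereal_inf.
  by apply/seteqP; split => // y [k Ak _]; apply: noA; exists k.
right; have exA : exists k, `[< A k >] by exists k; exact/asboolP.
case: (ex_minnP exA) => m /asboolP Am minm; have [W spW Wm] := Am.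
exists m, W; split => //; apply/eqP; rewrite eq_le; apply/andP; split.
  by apply: ereal_inf_lbound; exists m.
apply: le_ereal_inf_tmp => _ [l Al <-]; rewrite lee_fin ler_nat minm//.
exact/asboolP.
Qed.

Lemma log_vol_fiber_nbhd_le : exists c : R, forall T : nat,
  (- ereal_sup [set ((T.+1%:R : R)^-1)%:E * log2e (vol (fiber_nbhd S Q w T.+1 eps))
                 | w in admissible S Q]
   <= ((T.+1%:R : R)^-1)%:E * log2e (rinv S Q T.+1 K) + (c / T.+1%:R)%:E)%E.
Proof.
have [C CP] := spanning_vol_le.
(* A real positive lower bound of [vol K] makes [ln v] meaningful even if the volume is infinite. *)
have [v v0 vK] : exists2 v : R, 0 < v & (v%:E <= vol K)%E.
  case: (vol K) volK => [v| |]// v0; first by exists v.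
  by exists 1 => //; exact: leey.
exists ((ln C%:R - ln v) / ln 2) => T.
have T0 : (0 : R) < T.+1%:R^-1 by rewrite invr_gt0.
have [->|[k [W [spW Wk ->]]]] := rinv_attained T.+1.
  by rewrite log2ey gt0_muley ?lte_fin// addye// leey.
have [w aw /(le_trans vK) leV] := CP _ _ _ spW Wk.
apply: le_trans (oppe_log2e_le T0 v0 (measure_ge0 _ _) leV).
by rewrite leeN2; apply: ereal_sup_ubound; exists w.
Qed.

End spanning_bound.

Theorem lemma4p1 (R : realType) (n : nat) (M : pmetricType R)
  (X : riemannian_atlas n M)
  (connM : connected [set: M])
  (distM : is_riemannian_distance X)
  (leb : {measure set (borel 'rV[R]_n) -> \bar R})
  (lebP : is_lebesgue leb)
  (vol : {measure set (borel M) -> \bar R})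
  (volM : is_riemannian_volume X leb vol)
  (U : metricType R)
  (compU : compact [set: U])
  (connU : connected [set: U])
  (S : control_system X U)
  (Q : set M)
  (compQ : compact Q)
  (invQ : all_time_controlled_invariant S Q)
  (lscQ : fiber_lsc S Q)
  (K : set M)
  (compK : compact K)
  (KQ : K `<=` Q)
  (volK : (0 < vol K)%E)
  (eps : R)
  (eps_gt0 : 0 < eps) :
  (- limn_einf (fun tau : nat =>
       ereal_sup [set ((tau%:R : R)^-1)%:E * log2e (vol (fiber_nbhd S Q w tau eps))
                 | w in admissible S Q])
   <= hinv S K Q)%E.
Proof.
have [c cP] := log_vol_fiber_nbhd_le compU compQ invQ lscQ compK volK eps_gt0.
(* The negated lower limit is the upper limit of the negated sequence, and the error [c / k] falls
   below [e] once [k > c / e]. *)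
rewrite /limn_einf oppeK; apply: limn_esup_le_near => e e0.
near=> k; have k0 : (0 < k)%N by near: k; exact: nbhs_infty_gt.
rewrite -(prednK k0) (le_trans (cP k.-1))// leeD2l// lee_fin prednK//.
rewrite ler_pdivrMr ?ltr0n// mulrC -ler_pdivrMr// ltW//.
by near: k; exact: nbhs_infty_gtr.
Unshelve. all: by end_near. Qed.
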